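(* Let $\mathcal N$ be a nest on a complex Banach space $X$ with $\dim X\geq 2$, and let $\delta:\mathrm{Alg}\,\mathcal N\rightarrow \mathrm{Alg}\,\mathcal N$ be a linear map. Let $Z\in \mathrm{Alg}\,\mathcal N$ be an injective operator or an operator with dense range. Then $\delta$ is derivable at $Z$ if and only if $\delta$ is a derivation. That is, every injective operator in $\mathrm{Alg}\,\mathcal N$ and every operator with dense range in $\mathrm{Alg}\,\mathcal N$ is an all-derivable point of $\mathrm{Alg}\,\mathcal N$.
   Context: $\mathcal B(X)$ denotes the algebra of all bounded linear operators on $X$. A nest $\mathcal N$ on $X$ is a chain (under inclusion) of norm-closed linear subspaces of $X$ containing $\{0\}$ and $X$, which is closed under the formation of arbitrary closed linear spans and arbitrary intersections; the trivial nest $\{\{0\},X\}$ is allowed. The associated nest algebra is $\mathrm{Alg}\,\mathcal N=\{T\in\mathcal B(X): TN\subseteq N \text{ for every } N\in\mathcal N\}$. For an algebra $\mathcal A$, a linear map $\delta:\mathcal A\to\mathcal A$ is a derivation if $\delta(AB)=\delta(A)B+A\delta(B)$ for all $A,B\in\mathcal A$. A map $\varphi:\mathcal A\to\mathcal A$ is derivable at a point $Z\in\mathcal A$ if $\varphi(A)B+A\varphi(B)=\varphi(Z)$ for all $A,B\in\mathcal A$ with $AB=Z$. An element $Z\in\mathcal A$ is an all-derivable point of $\mathcal A$ if every linear map $\mathcal A\to\mathcal A$ that is derivable at $Z$ is a derivation. Linear maps on $\mathrm{Alg}\,\mathcal N$ are not assumed continuous. *)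

(* Defs.v *)
From HB Require Import structures.
From mathcomp Require Import all_boot all_order all_algebra.
From mathcomp Require Import boolp classical_sets functions.
From mathcomp Require Import reals topology normedtype.

Set Implicit Arguments.
Unset Strict Implicit.
Unset Printing Implicit Defensive.

Import Order.TTheory GRing.Theory Num.Theory.
Import numFieldNormedType.Exports.

Local Open Scope classical_set_scope.
Local Open Scope ring_scope.

(* At least n linearly independent vectors; X may be infinite-dimensional. *)
Definition dim_ge (K : numFieldType) (n : nat) (X : lmodType K) : Prop :=
  exists v : 'I_n -> X, forall c : 'I_n -> K,
    \sum_(i < n) c i *: v i = 0 -> forall i, c i = 0.

Section BoundedOperators.
Variables (K : numFieldType) (X : normedModType K).

Definition bounded_linear (f : X -> X) : Prop :=
  linear f /\ exists M : K, forall x, `|f x| <= M * `|x|.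

Definition bop_pred : {pred X -> X} := fun f => `[< bounded_linear f >].

Record bop := Bop { bop_val :> X -> X; _ : bop_val \in bop_pred }.

HB.instance Definition _ := [isSub of bop for bop_val].
HB.instance Definition _ := [Choice of bop by <:].

Lemma bopP (T : bop) : bounded_linear T.
Proof. exact/asboolP/(valP T). Qed.

Lemma bop_ext (S T : bop) : S =1 T -> S = T.
Proof. by move=> ST; apply/val_inj/funext. Qed.

Lemma bop_linear (T : bop) a x y : T (a *: x + y) = a *: T x + T y.
Proof. by have [+ _] := bopP T; apply. Qed.

Lemma bopD (T : bop) x y : T (x + y) = T x + T y.
Proof. by rewrite -[x]scale1r bop_linear !scale1r. Qed.

Lemma bop_ge0_bound (T : bop) :
  exists2 M : K, 0 <= M & forall x, `|T x| <= M * `|x|.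
Proof.
have [_ [M TM]] := bopP T; exists `|M| => // x.
have Mx : 0 <= M * `|x| := le_trans (normr_ge0 _) (TM x).
by rewrite -[`|x|]normr_id -normrM ger0_norm.
Qed.

Lemma bop_submod_closed : submod_closed bop_pred.
Proof.
split=> [|a f g].
  apply/asboolP; split=> [a x y|]; first by rewrite /= scaler0 addr0.
  by exists 0 => x; rewrite normr0 mul0r.
move=> /asboolP[lf [M fM]] /asboolP[lg [M' gM']].
apply/asboolP; split=> [b x y|].
  rewrite !fctE lf lg !scalerDr !scalerA (mulrC a) -!scalerA.
  by rewrite -!addrA; congr (_ + _); rewrite addrCA.
exists (`|a| * M + M') => x; rewrite !fctE.
apply: (le_trans (ler_normD _ _)); rewrite mulrDl lerD// normrZ -mulrA.
by rewrite ler_wpM2l.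
Qed.

HB.instance Definition _ :=
  GRing.isSubmodClosed.Build K (X -> X) bop_pred bop_submod_closed.
HB.instance Definition _ := [SubChoice_isSubLmodule of bop by <:].

Lemma bop1_subproof : (id : X -> X) \in bop_pred.
Proof. by apply/asboolP; split=> //; exists 1 => x; rewrite mul1r. Qed.

Lemma bopM_subproof (S T : bop) : (S \o T : X -> X) \in bop_pred.
Proof.
apply/asboolP; split=> [a x y|]; first by rewrite /= !bop_linear.
have [M M0 SM] := bop_ge0_bound S; have [M' _ TM] := bop_ge0_bound T.
exists (M * M') => x; apply: (le_trans (SM _)).
by rewrite -mulrA ler_wpM2l.
Qed.

Definition bop1 := Bop bop1_subproof.
Definition bop_mul (S T : bop) := Bop (bopM_subproof S T).

Lemma bop_mulA : associative bop_mul. Proof. by move=> *; apply: bop_ext. Qed.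
Lemma bop_mul1r : left_id bop1 bop_mul. Proof. by move=> *; apply: bop_ext. Qed.
Lemma bop_mulr1 : right_id bop1 bop_mul. Proof. by move=> *; apply: bop_ext. Qed.
Lemma bop_mulDl : left_distributive bop_mul +%R.
Proof. by move=> *; apply: bop_ext. Qed.
Lemma bop_mulDr : right_distributive bop_mul +%R.
Proof. by move=> S T U; apply: bop_ext => x; rewrite /= bopD. Qed.

(* MathComp's algType requires 1 != 0, which fails when X = 0; hence only a
   pzRingType (the product is composition) that is also a K-lmodType. *)
HB.instance Definition _ := GRing.Zmodule_isPzRing.Build bop
  bop_mulA bop_mul1r bop_mulr1 bop_mulDl bop_mulDr.

Lemma bop0E x : (0 : bop) x = 0. Proof. by []. Qed.
Lemma bop1E x : (1 : bop) x = x. Proof. by []. Qed.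
Lemma bopDE (S T : bop) x : (S + T) x = S x + T x. Proof. by []. Qed.
Lemma bopNE (T : bop) x : (- T) x = - T x. Proof. by []. Qed.
Lemma bopZE a (T : bop) x : (a *: T) x = a *: T x. Proof. by []. Qed.
Lemma bopME (S T : bop) x : (S * T) x = S (T x). Proof. by []. Qed.

End BoundedOperators.

Section Nests.
Variables (K : numFieldType) (X : normedModType K).

Definition linear_subspace (M : set X) : Prop :=
  M 0 /\ forall (a : K) x y, M x -> M y -> M (a *: x + y).

Definition closed_span (A : set X) : set X :=
  closure (smallest linear_subspace A).

(* F may be empty below: the span is then {0} and the intersection is X. *)
Record is_nest (N : set (set X)) : Prop := IsNest {
  nest_subspace : forall M, N M -> linear_subspace M;
  nest_closed : forall M, N M -> closed M;
  nest_chain : total_on N (@subset X);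
  nest0 : N [set 0];
  nestT : N setT;
  nest_span : forall F, F `<=` N -> N (closed_span (\bigcup_(M in F) M));
  nest_bigcap : forall F, F `<=` N -> N (\bigcap_(M in F) M) }.

Record nest := Nest { nest_sets : set (set X); nestP : is_nest nest_sets }.

End Nests.

Section NestAlgebra.
Variables (K : numFieldType) (X : normedModType K) (N : nest X).

Definition alg_pred : {pred bop X} :=
  fun T => `[< forall M, nest_sets N M -> T @` M `<=` M >].

Record alg := Alg { alg_val :> bop X; _ : alg_val \in alg_pred }.

HB.instance Definition _ := [isSub of alg for alg_val].
HB.instance Definition _ := [Choice of alg by <:].

Lemma algP (T : alg) M x : nest_sets N M -> M x -> M (T x).
Proof. by case: T => T /= /asboolP NT NM Mx; apply: (NT M NM); exists x. Qed.

Lemma alg_submod_closed : submod_closed alg_pred.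
Proof.
split=> [|a S T /asboolP NS /asboolP NT]; apply/asboolP.
  by move=> M /(nest_subspace (nestP N))[M0 _] _ [x _ <-].
move=> M NM _ [x Mx <-]; have [_ Mlin] := nest_subspace (nestP N) NM.
by apply: Mlin; [apply: (NS M NM) | apply: (NT M NM)]; exists x.
Qed.

HB.instance Definition _ :=
  GRing.isSubmodClosed.Build K (bop X) alg_pred alg_submod_closed.

Lemma alg_mulr_closed : mulr_closed alg_pred.
Proof.
split=> [|S T /asboolP NS /asboolP NT]; apply/asboolP.
  by move=> M NM _ [x Mx <-].
move=> M NM _ [x Mx <-]; apply: (NS M NM); exists (T x) => //.
by apply: (NT M NM); exists x.
Qed.

HB.instance Definition _ :=
  GRing.isMulClosed.Build (bop X) alg_pred alg_mulr_closed.

HB.instance Definition _ := [SubChoice_isSubLmodule of alg by <:].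
HB.instance Definition _ :=
  GRing.SubZmodule_isSubPzRing.Build _ _ alg (subringClosedP _).

(* Linearity is part of the type of delta. *)
Definition derivation (delta : {linear alg -> alg}) : Prop :=
  forall A B : alg, delta (A * B) = delta A * B + A * delta B.

Definition derivable_at (phi : alg -> alg) (Z : alg) : Prop :=
  forall A B : alg, A * B = Z -> phi A * B + A * phi B = phi Z.

Definition all_derivable_point (Z : alg) : Prop :=
  forall phi : {linear alg -> alg}, derivable_at phi Z -> derivation phi.

Lemma alg_ext (S T : alg) : S =1 T -> S = T.
Proof. by move=> ST; apply/val_inj/bop_ext. Qed.

Lemma algDE (S T : alg) x : (S + T) x = S x + T x. Proof. by []. Qed.
Lemma algZE a (T : alg) x : (a *: T) x = a *: T x. Proof. by []. Qed.
Lemma algME (S T : alg) x : (S * T) x = S (T x). Proof. by []. Qed.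
Lemma alg1E x : (1 : alg) x = x. Proof. by []. Qed.

End NestAlgebra.

(* Main.v *)
(* Let delta be derivable at Z. Since A A^-1 Z = Z, comparing the values of
   delta at (1 - S)^-1 Z, (1 + S)^-1 Z and (1 - S^2)^-1 Z for small S, which
   are related by (1 - S)^-1 + (1 + S)^-1 = 2 (1 - S^2)^-1, and cancelling Z
   on the right when its range is dense, shows that delta is a Jordan
   derivation; when Z is injective the same is done with Z A^-1 A = Z. No
   continuity of delta is involved.

   For a Jordan derivation the defect D(A, B) = delta(AB) - delta(A)B - A
   delta(B) is alternating and satisfies the Hochschild cocycle identity, and
   two consequences drive the argument: D(A, RS) = 0 for all A as soon as SR
   = 0 and D(S, R) = 0, and D(A, B) R = 0 as soon as D(., R) and D(A, BR)
   vanish. So it is enough to kill D(., R) for enough rank-one operators R =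
   x (x) f : y |-> f(y) x. Let U be the closed span of the proper members of
   the nest. If U <> X, take f annihilating U with f(v) = 1: then v (x) f is
   a rank-one idempotent and x (x) f is in the algebra for every x. If U = X,
   every proper member P has a chain P < P' < Q < Q' of proper members above
   it, and x (x) f with x in P and f annihilating Q' factors through Q and P'
   as a product RS with SR = 0 and D(S, R) = 0. *)
Require Import Defs.
From HB Require Import structures.
From mathcomp Require Import all_boot all_order all_algebra.
From mathcomp Require Import boolp classical_sets functions.
From mathcomp Require Import reals topology normedtype.
From mathcomp Require Import complex.
From mathcomp Require Import ring lra.

Import numFieldNormedType.Exports.
Local Open Scope classical_set_scope.
Local Open Scope ring_scope.

Set Implicit Arguments.
Unset Strict Implicit.
Unset Printing Implicit Defensive.

Import Order.TTheory GRing.Theory Num.Theory.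

(** * Jordan derivations of rings *)

Definition jordan_derivation (A : pzRingType) (phi : A -> A) : Prop :=
  forall a, phi (a * a) = phi a * a + a * phi a.

Section DerivationDefect.
Variables (A : pzRingType) (phi : {additive A -> A}).

Definition defect a b := phi (a * b) - phi a * b - a * phi b.

Definition defect3 a b c :=
  phi (a * b * c) - phi a * b * c - a * phi b * c - a * b * phi c.

Lemma defect0l b : defect 0 b = 0.
Proof. by rewrite /defect !mul0r raddf0 mul0r !subr0. Qed.

Lemma defectDl a a' b : defect (a + a') b = defect a b + defect a' b.
Proof.
rewrite /defect !mulrDl !raddfD /= mulrDl !opprD.
by rewrite [X in X + _]addrACA [LHS]addrACA.
Qed.

Lemma defectDr a b b' : defect a (b + b') = defect a b + defect a b'.
Proof.
rewrite /defect !mulrDr !raddfD /= mulrDr !opprD.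
by rewrite [X in X + _]addrACA [LHS]addrACA.
Qed.

Lemma defect3El a b c : defect3 a b c = defect (a * b) c + defect a b * c.
Proof.
rewrite /defect3 /defect !mulrBl addrAC addrACA -!addrA; congr (_ + _).
by rewrite addKr.
Qed.

Lemma defect3Er a b c : defect3 a b c = defect a (b * c) + a * defect b c.
Proof. by rewrite /defect3 /defect !mulrBr !mulrA !addrA subrK. Qed.

Hypothesis torsion2 : forall a : A, a + a = 0 -> a = 0.
Hypothesis phiJ : jordan_derivation phi.

Lemma defectaa a : defect a a = 0.
Proof. by rewrite /defect phiJ addrAC addrK subrr. Qed.

Lemma defectC a b : defect a b = - defect b a.
Proof.
apply/eqP; rewrite -addr_eq0; apply/eqP; have := defectaa (a + b).
by rewrite defectDl !defectDr !defectaa add0r addr0.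
Qed.

Lemma defect3_cycle a b c :
  defect3 a b c + defect3 b c a = a * defect b c + defect b c * a.
Proof.
rewrite defect3Er defect3El [defect (b * c) a]defectC.
by rewrite addrAC addrA subrr add0r addrC.
Qed.

Lemma defect3_double a b c : defect3 a b c + defect3 a b c =
  (c * defect a b + defect a b * c) + (a * defect b c + defect b c * a)
  - (b * defect c a + defect c a * b).
Proof.
rewrite -!defect3_cycle [defect3 c a b + _]addrC [X in _ = X - _]addrACA.
by rewrite [defect3 c a b + _]addrC addrK.
Qed.

Lemma defect3C a b c : defect3 a b c = - defect3 c b a.
Proof.
apply/eqP; rewrite -addr_eq0; apply/eqP/torsion2.
rewrite addrACA !defect3_double [defect c b]defectC [defect b a]defectC.
rewrite [defect a c]defectC !(mulrN, mulNr) -!opprD; apply/eqP.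
by rewrite subr_eq0 [X in X - _ == _]addrC.
Qed.

Lemma defect_eq0_mul r s a :
  s * r = 0 -> defect s r = 0 -> defect a (r * s) = 0.
Proof.
move=> sr0 Dsr; have := defect3Er a r s.
rewrite defect3C defect3El sr0 Dsr defect0l mul0r addr0 oppr0.
by rewrite [defect r s]defectC Dsr oppr0 mulr0 addr0.
Qed.

Lemma defect_mul_eq0 a b r :
  (forall c, defect c r = 0) -> defect a (b * r) = 0 -> defect a b * r = 0.
Proof.
move=> Dr Dbr; have := defect3El a b r.
by rewrite defect3Er Dbr !Dr mulr0 !add0r.
Qed.

Lemma jordanD a b :
  phi (a * b + b * a) = (phi a * b + a * phi b) + (phi b * a + b * phi a).
Proof.
have /eqP := defectC a b; rewrite -addr_eq0 => /eqP; rewrite /defect => E.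
apply/eqP; rewrite -subr_eq0 raddfD /= -[X in _ == X]E.
by rewrite opprD addrACA !opprD !addrA.
Qed.

End DerivationDefect.

Section LocallyDerivable.
Variables (A : pzRingType) (phi : {additive A -> A}) (z : A).
Hypothesis torsion2 : forall a : A, a + a = 0 -> a = 0.
Hypothesis z_cancel : forall a, a * z = 0 -> a = 0.
Hypothesis phiz : forall a b, a * b = z -> phi a * b + a * phi b = phi z.

Lemma derivable_at1 : phi 1 = 0.
Proof.
apply: z_cancel; apply: (addIr (phi z)).
by rewrite add0r -[RHS](phiz (mul1r z)) mul1r.
Qed.

Lemma derivable_at_inv a u : u * a = 1 -> a * u = 1 ->
  phi (u * z) = u * phi z - u * phi a * u * z.
Proof.
move=> ua au; have auz : a * (u * z) = z by rewrite mulrA au mul1r.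
rewrite -(phiz auz) mulrDr mulrA [u * (a * _)]mulrA ua mul1r.
by rewrite !mulrA [RHS]addrC addKr.
Qed.

Lemma derivable_at_jordan (s u w : A) :
  u * (1 - s) = 1 -> (1 - s) * u = 1 -> w * (1 + s) = 1 -> (1 + s) * w = 1 ->
  phi (s * s) = phi s * s + s * phi s.
Proof.
move=> us su ws sw; pose q := u * w; pose d := 1 - s * s.
have dE : d = (1 - s) * (1 + s).
  by rewrite mulrDr mulr1 mulrBl mul1r addrA subrK.
have dE' : d = (1 + s) * (1 - s).
  by rewrite mulrBr mulr1 mulrDl mul1r opprD addrA addrK.
have uw2 : u + w = q + q.
  have uE : u = u * (1 + s) * w by rewrite -mulrA sw mulr1.
  have wE : w = u * (1 - s) * w by rewrite us mul1r.
  rewrite {1}uE {2}wE -mulrDl -mulrDr addrACA subrr addr0.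
  by rewrite mulrDr mulr1 mulrDl.
have qd : q * d = 1 by rewrite dE' /q mulrA -[u * w * _]mulrA ws mulr1.
have dq : d * q = 1 by rewrite dE' /q mulrA -[_ * _ * u]mulrA su mulr1.
have phiB t : phi (1 - t) = - phi t.
  by rewrite raddfB /= derivable_at1 sub0r.
have uz : phi (u * z) = u * phi z + u * phi s * u * z.
  by rewrite (derivable_at_inv us su) phiB mulrN !mulNr opprK.
have wz : phi (w * z) = w * phi z - w * phi s * w * z.
  by rewrite (derivable_at_inv ws sw) raddfD /= derivable_at1 add0r.
have qz : phi (q * z) = q * phi z + q * phi (s * s) * q * z.
  by rewrite (derivable_at_inv qd dq) phiB mulrN !mulNr opprK.
clearbody q; have E : u * phi s * u - w * phi s * w =
    q * phi (s * s) * q + q * phi (s * s) * q.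
  apply/eqP; rewrite -subr_eq0; apply/eqP/z_cancel.
  apply/eqP; rewrite mulrBl subr_eq0; apply/eqP.
  have /(congr1 phi) := congr1 (fun x => x * z) uw2.
  rewrite !mulrDl !raddfD /= uz wz qz addrACA [RHS]addrACA -!mulrDl uw2.
  by move/addrI; rewrite mulrBl.
have {}E := congr1 (fun x => d * x * d) E.
have du : d * u = 1 + s by rewrite dE' -mulrA su mulr1.
have ud : u * d = 1 + s by rewrite dE mulrA us mul1r.
have dw : d * w = 1 - s by rewrite dE -mulrA sw mulr1.
have wd : w * d = 1 - s by rewrite dE' mulrA ws mul1r.
clearbody d; move: E => /=; rewrite mulrBr mulrDr mulrBl mulrDl.
rewrite !mulrA du dw dq !mul1r.
rewrite -![_ * _ * d]mulrA ud wd qd !mulr1.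
have expand t : (1 + t) * phi s * (1 + t) =
    (phi s * t + t * phi s) + (phi s + t * phi s * t).
  rewrite mulrDr !mulrDl !mul1r !mulr1 [X in X + _ = _]addrC [LHS]addrACA.
  by rewrite [X in X + _ = _]addrC.
rewrite !expand !(mulrN, mulNr) opprK -opprD.
rewrite [X in _ - X]addrC opprB addrACA subrr addr0.
move/eqP; rewrite eq_sym -subr_eq0 opprD addrACA => /eqP/torsion2/eqP.
by rewrite subr_eq0 => /eqP.
Qed.

End LocallyDerivable.

(** * Hahn-Banach separation *)

Section HahnBanach.
Variables (R : realType) (V : lmodType R).

Definition sublinear (p : V -> R) : Prop :=
  (forall x y, p (x + y) <= p x + p y) /\
  (forall t x, 0 <= t -> p (t *: x) <= t * p x).

Lemma sublinear0 p : sublinear p -> p 0 = 0.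
Proof.
move=> [pD pZ]; apply/eqP; rewrite eq_le; apply/andP; split.
  by have := pZ 0 0 (lexx 0); rewrite scale0r mul0r.
by have := pD 0 0; rewrite addr0 -lerBlDr subrr.
Qed.

Lemma sublinear_opp p x : sublinear p -> - p (- x) <= p x.
Proof.
move=> sp; have [pD _] := sp; rewrite -subr_ge0 opprK.
by rewrite -(sublinear0 sp) -(subrr x) pD.
Qed.

Lemma sublinearZ p t x : sublinear p -> 0 <= t -> p (t *: x) = t * p x.
Proof.
move=> sp t0; have [_ pZ] := sp.
have := t0; rewrite le_eqVlt => /predU1P[<-|tgt0].
  by rewrite scale0r mul0r sublinear0.
apply/eqP; rewrite eq_le pZ//= -ler_pdivlMl//.
rewrite -{1}[x]scale1r -(mulVf (lt0r_neq0 tgt0)) -scalerA.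
by rewrite pZ// invr_ge0.
Qed.

(* S lists constraints [r <= g c] to be imposed on a linear g below p. *)
Definition conical (S : set (V * R)) : Prop :=
  [/\ S (0, 0),
      forall c r d s, S (c, r) -> S (d, s) -> S (c + d, r + s) &
      forall t c r, 0 < t -> S (c, r) -> S (t *: c, t * r)].

Lemma sublinear_conical p (S : set (V * R)) :
  sublinear p -> conical S -> (forall c r, S (c, r) -> r <= p c) ->
  exists q, [/\ sublinear q, forall x, q x <= p x &
                forall c r, S (c, r) -> q (- c) <= - r].
Proof.
move=> sp [S0 SD SZ] Sp; have [pD pZ] := sp.
pose E x := [set p (x + c.1) - c.2 | c in S].
have lbE x : lbound (E x) (- p (- x)).
  move=> _ [[c r] Sc <-] /=; rewrite lerBrDl lerBlDr.
  apply: (le_trans (Sp c r Sc)).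
  by rewrite -{1}[c](addKr x) addrC pD.
have infE x : has_inf (E x).
  split; last by exists (- p (- x)); exact: lbE.
  by exists (p (x + 0) - 0), (0, 0).
have leE x c r : S (c, r) -> inf (E x) <= p (x + c) - r.
  by move=> Sc; apply: ge_inf; [exact: (infE x).2 | exists (c, r)].
exists (fun x => inf (E x)); split.
- have q0 : inf (E 0) <= 0.
    by have := leE 0 _ _ S0; rewrite /= addr0 subr0 sublinear0.
  split=> [x y|t x].
    rewrite -lerBlDr; apply: lb_le_inf; first exact: (infE x).1.
    move=> _ [[c r] Sc <-] /=; rewrite lerBlDl -lerBlDr.
    apply: lb_le_inf; first exact: (infE y).1.
    move=> _ [[d s] Sd <-] /=; rewrite lerBlDr.
    apply: (le_trans (leE _ _ _ (SD _ _ _ _ Sc Sd))) => /=.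
    by have := pD (x + c) (y + d); rewrite addrACA; lra.
  rewrite le_eqVlt => /predU1P[<-|t0]; first by rewrite scale0r mul0r.
  rewrite mulrC -ler_pdivrMr//; apply: lb_le_inf; first exact: (infE x).1.
  move=> _ [[c r] Sc <-] /=; rewrite ler_pdivrMr// mulrC mulrBr.
  apply: (le_trans (leE _ _ _ (SZ _ _ _ t0 Sc))) => /=.
  by rewrite lerD2r -scalerDr pZ// ltW.
- by move=> x; have := leE x _ _ S0; rewrite /= addr0 subr0.
- by move=> c r Sc; have := leE (- c) _ _ Sc; rewrite addNr sublinear0// sub0r.
Qed.

Lemma minimal_sublinear p : sublinear p ->
  exists q, [/\ sublinear q, forall x, q x <= p x &
    forall q', sublinear q' -> (forall x, q' x <= q x) -> q' = q].
Proof.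
move=> sp; have [pD pZ] := sp.
pose T := {q : V -> R | sublinear q /\ forall x, q x <= p x}.
pose le (s t : T) := `[< forall x, sval t x <= sval s x >].
have [||||t tmin] := @Zorn T le.
- by move=> t; apply/asboolP.
- move=> r s t /asboolP rs /asboolP st; apply/asboolP => x.
  exact: le_trans (st x) (rs x).
- move=> [s s'] [t t'] /asboolP /= st /asboolP /= ts.
  apply/eq_exist/funext => x.
  by apply/le_anti; rewrite st ts.
- move=> C Ctot; have [->|/set0P[s0 Cs0]] := eqVneq C set0.
    by exists (exist _ p (conj sp (fun x => lexx (p x)))) => s [].
  pose E x := [set sval s x | s in C].
  have lbE x : lbound (E x) (- p (- x)).
    move=> _ [[s [ss sp']] Cs <-] /=.
    by rewrite (le_trans _ (sublinear_opp x ss))// lerN2.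
  have infE x : has_inf (E x).
    by split; [exists (sval s0 x), s0 | exists (- p (- x)); exact: lbE].
  have leE s x : C s -> inf (E x) <= sval s x.
    by move=> Cs; apply: ge_inf; [exact: (infE x).2 | exists s].
  pose q x := inf (E x).
  have sq : sublinear q.
    split=> [x y|u x].
      rewrite -lerBlDr; apply: lb_le_inf; first exact: (infE x).1.
      move=> _ [s Cs <-]; rewrite lerBlDl -lerBlDr.
      apply: lb_le_inf; first exact: (infE y).1.
      move=> _ [t Ct <-]; rewrite lerBlDr.
      have [/asboolP st|/asboolP ts] := Ctot _ _ Cs Ct.
        apply: (le_trans (leE t _ Ct)); have [[tD _] _] := svalP t.
        by apply: (le_trans (tD _ _)); rewrite addrC lerD2l.
      apply: (le_trans (leE s _ Cs)); have [[sD _] _] := svalP s.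
      by apply: (le_trans (sD _ _)); rewrite addrC lerD2r.
    rewrite le_eqVlt => /predU1P[<-|u0].
      rewrite scale0r mul0r (le_trans (leE s0 _ Cs0))//.
      by have [/sublinear0-> _] := svalP s0.
    rewrite mulrC -ler_pdivrMr//; apply: lb_le_inf; first exact: (infE x).1.
    move=> _ [s Cs <-]; rewrite ler_pdivrMr// mulrC.
    apply: (le_trans (leE s _ Cs)); have [[_ sZ] _] := svalP s.
    by rewrite sZ// ltW.
  have qp x : q x <= p x.
    by apply: (le_trans (leE s0 x Cs0)); have [_] := svalP s0.
  by exists (exist _ q (conj sq qp)) => s Cs; apply/asboolP => x; exact: leE.
exists (sval t); have [st tp] := svalP t; split=> // q sq qt.
have qp x : q x <= p x := le_trans (qt x) (tp x).
by have <- // := tmin (exist _ q (conj sq qp)); apply/asboolP.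
Qed.

Lemma minimal_sublinear_opp q v : sublinear q ->
  (forall q', sublinear q' -> (forall x, q' x <= q x) -> q' = q) ->
  q (- v) = - q v.
Proof.
move=> sq qmin.
pose S := [set c : V * R | exists2 t, 0 <= t & c = (t *: v, t * q v)].
have [||q' [sq' q'q q'S]] := @sublinear_conical q S sq.
- split.
  + by exists 0; rewrite ?scale0r ?mul0r.
  + move=> _ _ _ _ [t t0 [-> ->]] [u u0 [-> ->]]; exists (t + u).
      exact: addr_ge0.
    by rewrite scalerDl mulrDl.
  + move=> t _ _ t0 [u u0 [-> ->]]; exists (t * u).
      by rewrite mulr_ge0// ltW.
    by rewrite scalerA mulrA.
- by move=> _ _ [t t0 [-> ->]]; rewrite sublinearZ.
apply/eqP; rewrite eq_le; apply/andP; split.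
  have := q'S v (q v); rewrite (qmin _ sq' q'q); apply.
  by exists 1; rewrite ?ler01// scale1r mul1r.
by have := sublinear_opp (- v) sq; rewrite opprK.
Qed.

(* A minimal sublinear functional is linear. *)
Lemma hahn_banach p (S : set (V * R)) :
  sublinear p -> conical S -> (forall c r, S (c, r) -> r <= p c) ->
  exists g : V -> R, [/\ forall x y, g (x + y) = g x + g y,
    forall t x, g (t *: x) = t * g x, forall x, g x <= p x &
    forall c r, S (c, r) -> r <= g c].
Proof.
move=> sp cS Sp; have [q [sq qp qS]] := sublinear_conical sp cS Sp.
have [g [sg gq gmin]] := minimal_sublinear sq.
have gN v : g (- v) = - g v by exact: minimal_sublinear_opp.
have [gD gZ] := sg.
exists g; split.
- move=> x y; apply/eqP; rewrite eq_le gD/= -lerN2 opprD -!gN opprD.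
  exact: gD.
- move=> t x; have [t0|t0] := leP 0 t; first exact: sublinearZ.
  rewrite -[t]opprK scaleNr gN sublinearZ ?mulNr//.
  by rewrite oppr_ge0 ltW.
- by move=> x; exact: le_trans (gq x) (qp x).
- by move=> c r Sc; rewrite -lerN2 -gN (le_trans (gq _))// qS.
Qed.

End HahnBanach.

Definition realify (R : realType) (X : lmodType R[i]) : Type := X.

Section Realify.
Variables (R : realType) (X : lmodType R[i]).

HB.instance Definition _ := GRing.Zmodule.on (realify X).

Definition realify_scale (t : R) (x : realify X) : realify X :=
  (t%:C)%C *: (x : X).

Lemma realify_scaleA a b x :
  realify_scale a (realify_scale b x) = realify_scale (a * b) x.
Proof. by rewrite /realify_scale scalerA rmorphM. Qed.

Lemma realify_scale1 : left_id 1 realify_scale.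
Proof. by move=> x; rewrite /realify_scale rmorph1 scale1r. Qed.

Lemma realify_scaleDr : right_distributive realify_scale +%R.
Proof. by move=> a x y; rewrite /realify_scale scalerDr. Qed.

Lemma realify_scaleDl x : {morph realify_scale^~ x : a b / a + b}.
Proof. by move=> a b; rewrite /realify_scale rmorphD scalerDl. Qed.

HB.instance Definition _ := GRing.Zmodule_isLmodule.Build R (realify X)
  realify_scaleA realify_scale1 realify_scaleDr realify_scaleDl.

End Realify.

Definition bounded_functional (K : numFieldType) (X : normedModType K)
    (f : X -> K) : Prop :=
  scalar f /\ exists m, forall x, `|f x| <= m * `|x|.

Section SeparatingFunctional.
Variables (R : realType) (X : normedModType R[i]).

Definition rnorm (x : X) : R := complex.Re `|x|.

Lemma rnormE x : ((rnorm x)%:C)%C = `|x|.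
Proof. exact/RRe_real/normr_real. Qed.

Lemma normc_real (t : R) : `|(t%:C)%C| = (`|t|%:C)%C.
Proof. by rewrite normc_def /= expr0n addr0 sqrtr_sqr. Qed.

Lemma normci : `|'i%C : R[i]| = 1.
Proof. by rewrite normc_def /= expr0n expr1n add0r sqrtr1. Qed.

Lemma sublinear_rnorm : sublinear (rnorm : realify X -> R).
Proof.
split=> [x y|t x t0].
  by rewrite -lecR rmorphD /= !rnormE; exact: ler_normD.
by rewrite -lecR rmorphM /= !rnormE normrZ ger0_norm// lecR.
Qed.

Lemma complexify_functional (g : X -> R) :
  (forall x y, g (x + y) = g x + g y) ->
  (forall t x, g ((t%:C)%C *: x) = t * g x) ->
  (forall x, g x <= rnorm x) ->
  bounded_functional (fun x => Complex (g x) (- g ('i%C *: x))).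
Proof.
move=> gD gZ gle; split=> [a x y|].
  have gaZ b z :
      g (b *: z) = complex.Re b * g z + complex.Im b * g ('i%C *: z).
    by rewrite -!gZ -gD [in LHS](complexE b) scalerDl ['i%C * _]mulrC -scalerA.
  have iaZ : 'i%C *: (a *: x) = a *: ('i%C *: x).
    by rewrite !scalerA mulrC.
  have iiZ (z : X) : 'i%C *: ('i%C *: z) = - z.
    by rewrite scalerA -expr2 sqr_i scaleN1r.
  have gN z : g (- z) = - g z.
    by rewrite -[RHS]mulN1r -gZ rmorphN rmorph1 scaleN1r.
  apply/eqP; rewrite eq_complex scalerDr iaZ !gD !(gaZ a) iiZ gN /=.
  by apply/andP; split; apply/eqP; case: a {iaZ} => a b /=; ring.
exists 2 => x.
have gabs z : `|g z| <= rnorm z.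
  rewrite ler_norml gle andbT lerNl -[- g z]mulN1r -gZ rmorphN rmorph1 scaleN1r.
  by rewrite (le_trans (gle _))// -lecR !rnormE normrN.
rewrite [X in `|X|]complexE /= (le_trans (ler_normD _ _))//.
rewrite normrM normci mul1r mulr2n mulrDl mul1r lerD//.
  by rewrite -rnormE normc_real lecR.
rewrite rmorphN normrN normc_real -[`|x|]mul1r -normci -normrZ -rnormE lecR.
exact: gabs.
Qed.

Lemma separating_functional (M : set X) (v : X) :
  linear_subspace M -> closed M -> ~ M v ->
  exists f : X -> R[i],
    [/\ bounded_functional f, forall x, M x -> f x = 0 & f v = 1].
Proof.
move=> [M0 Mlin] clM Mv.
have MN x : M x -> M (- x).
  by move=> Mx; rewrite -[- x]addr0 -scaleN1r; exact: Mlin.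
have MD x y : M x -> M y -> M (x + y) by rewrite -{2}[x]scale1r; exact: Mlin.
have MZ t x : M x -> M (t *: x) by rewrite -[t *: x]addr0 => Mx; exact: Mlin.
have [d d0 dM] : exists2 d : R, 0 < d & forall m, M m -> d <= rnorm (v + m).
  have /closed_openC := clM; rewrite openE => /(_ v Mv).
  move=> /nbhs_ballP[e /= e0 eM]; exists (complex.Re e).
    by rewrite -ltcR RRe_real ?gtr0_real.
  move=> m /MN Mm; rewrite leNgt; apply/negP => vme; apply: (eM (- m)) => //.
  by rewrite -ball_normE /= opprK -rnormE -[e]RRe_real ?gtr0_real// ltcR.
pose S := [set c : realify X * R | exists t m, [/\ 0 <= t, M m &
  c = (t *: (v : realify X) + (m : realify X), t * d)]].
have [|||g [gD gZ gle gS]] := @hahn_banach R (realify X) rnorm S.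
- exact: sublinear_rnorm.
- split.
  + by exists 0, 0; rewrite scale0r addr0 mul0r.
  + move=> _ _ _ _ [t [m [t0 Mm [-> ->]]]] [u [n [u0 Mn [-> ->]]]].
    exists (t + u), (m + n); rewrite addr_ge0// scalerDl mulrDl addrACA.
    by split=> //; exact: MD.
  + move=> r _ _ r0 [t [m [t0 Mm [-> ->]]]]; exists (r * t), ((r%:C)%C *: m).
    rewrite mulr_ge0 ?(ltW r0)// [X in (X, _)]scalerDr scalerA mulrA.
    by split=> //; exact: MZ.
- move=> _ _ [t [m [t0 Mm [-> ->]]]]; have := t0; rewrite le_eqVlt.
  move=> /predU1P[<-|tgt0].
    by rewrite mul0r -lecR rnormE rmorph0.
  have E : t *: ((v : realify X) + t^-1 *: (m : realify X)) =
      t *: (v : realify X) + (m : realify X).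
    by rewrite scalerDr scalerA divff ?scale1r ?gt_eqF.
  rewrite -E (sublinearZ _ sublinear_rnorm)// ler_wpM2l//.
  by apply: dM; exact: MZ.
have gv : 0 < g v.
  apply: (lt_le_trans d0); apply: (gS v d).
  by exists 1, 0; rewrite scale1r addr0 mul1r.
have gM m : M m -> g m = 0.
  move=> Mm; have gM0 n : M n -> 0 <= g n.
    move=> Mn; apply: (gS n 0).
    by exists 0, n; rewrite scale0r add0r mul0r.
  apply/eqP; rewrite eq_le gM0// andbT -oppr_ge0 -mulN1r -gZ scaleN1r.
  exact/gM0/MN.
have [Flin [k Fk]] := @complexify_functional g gD gZ gle.
pose F (x : X) : R[i] := Complex (g x) (- g ('i%C *: x)).
have Fv : F v != 0 by rewrite eq_complex /= negb_and gt_eqF.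
exists (fun x => (F v)^-1 * F x); split.
- split=> [a x y|]; first by rewrite /F Flin mulrDr mulrCA.
  exists (`|(F v)^-1| * k) => x.
  by rewrite normrM -mulrA ler_wpM2l//; exact: Fk.
- move=> x Mx; have -> : F x = 0.
    by rewrite /F (gM _ Mx) (gM _ (MZ _ _ Mx)) oppr0.
  by rewrite mulr0.
- by rewrite mulVf.
Qed.

End SeparatingFunctional.

(** * Invertibility in a nest algebra *)

Section AlgLinear.
Variables (K : numFieldType) (X : normedModType K) (N : nest X).
Implicit Types (S T : alg N) (x y : X).

Lemma alg_mapD T x y : T (x + y) = T x + T y.
Proof. exact: bopD. Qed.

Lemma alg_map0 T : T 0 = 0.
Proof. by apply: (addIr (T 0)); rewrite -alg_mapD !add0r. Qed.

Lemma alg_mapZ T a x : T (a *: x) = a *: T x.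
Proof. by rewrite -[a *: x]addr0 (bop_linear T) alg_map0 addr0. Qed.

Lemma alg_mapN T x : T (- x) = - T x.
Proof. by rewrite -scaleN1r alg_mapZ scaleN1r. Qed.

Lemma alg_mapB T x y : T (x - y) = T x - T y.
Proof. by rewrite alg_mapD alg_mapN. Qed.

Lemma algNE T x : (- T) x = - T x.
Proof. by []. Qed.

End AlgLinear.

Lemma exists_lt_exp2 (R : realType) (c e : R[i]) :
  0 <= c -> 0 < e -> exists n, c < e * 2 ^+ n.
Proof.
move=> c0 e0; have cE := RRe_real (ger0_real c0).
have eE := RRe_real (gtr0_real e0).
move: c0 e0; rewrite -cE -eE; set a := complex.Re c; set b := complex.Re e.
rewrite -(rmorph0 (real_complex R)) lecR ltcR => a0 b0.
exists (Num.bound (a / b)).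
rewrite -(rmorph_nat (real_complex R)) -rmorphXn -rmorphM /= ltcR.
rewrite mulrC -ltr_pdivrMr// (lt_le_trans (archi_boundP _))//.
  by rewrite divr_ge0// ltW.
by rewrite -natrX ler_nat ltnW// ltn_expl.
Qed.

Section Neumann.
Variables (R : realType) (X : completeNormedModType R[i]).

Lemma cvg_of_geometric_dist (u : nat -> X) (c : R[i]) : 0 <= c ->
  (forall n, `|u n.+1 - u n| <= c / 2 ^+ n) -> cvg (u @ \oo).
Proof.
move=> c0 uc.
have udist n m : `|u n - u (n + m)%N| <=
      2 * c / 2 ^+ n - 2 * c / 2 ^+ (n + m)%N.
  elim: m => [|m IH]; first by rewrite addn0 !subrr normr0.
  rewrite (le_trans (ler_distD (u (n + m)%N) _ _))//.
  rewrite -[leRHS](subrK (2 * c / 2 ^+ n - 2 * c / 2 ^+ (n + m)%N)).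
  rewrite addrC lerD// distrC addnS (le_trans (uc _))//.
  rewrite exprS le_eqVlt; apply/orP; left; apply/eqP; field.
  by rewrite !expf_neq0 ?pnatr_eq0.
apply/cauchy_cvgP/cauchy_exP => e e0.
have [n nP] := exists_lt_exp2 (mulr_ge0 (ler0n _ 2) c0) e0.
exists (u n); exists n => // m /= nm; rewrite -ball_normE /=.
rewrite -(subnKC nm) (le_lt_trans (udist _ _))//.
rewrite (@le_lt_trans _ _ (2 * c / 2 ^+ n))//.
  by rewrite lerBlDr lerDl divr_ge0 ?mulr_ge0 ?exprn_ge0.
by rewrite ltr_pdivrMr ?exprn_gt0.
Qed.

Variable N : nest X.

Lemma neumann_fixpoint (S : alg N) (x : X) :
  (forall y, `|S y| <= 2^-1 * `|y|) ->
  exists l, l = x + S l /\ forall M, nest_sets N M -> M x -> M l.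
Proof.
move=> hS; pose u n := iter n (fun w => x + S w) 0.
have uc n : `|u n.+1 - u n| <= `|x| / 2 ^+ n.
  elim: n => [|n IH].
    by rewrite /u /= subr0 expr0 divr1 alg_map0 addr0.
  rewrite [u n.+2]/= [X in _ - X]/= opprD addrACA subrr add0r -alg_mapB.
  apply: (le_trans (hS _)); rewrite exprS invfM mulrCA ler_wpM2l ?invr_ge0//.
have /cvg_ex[l ul] := cvg_of_geometric_dist (normr_ge0 x) uc.
exists l; split.
  apply/eqP; rewrite -subr_eq0 -normr_eq0; apply/negP => /negP ln0.
  have e0 : 0 < `|l - (x + S l)| by rewrite lt_def ln0 /=.
  have /cvgrPdist_lt/(_ _ (divr_gt0 e0 (ltr0n _ 2)))[n _ nP] := ul.
  suff : `|l - (x + S l)| < `|l - (x + S l)| by rewrite ltxx.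
  rewrite {1}(_ : l - (x + S l) = (l - u n.+1) + S (u n - l)); last first.
    by rewrite alg_mapB /= !opprD !addrA subrK.
  rewrite (le_lt_trans (ler_normD _ _))// [ltRHS]splitr ltr_leD//.
    by apply: nP => /=.
  rewrite (le_trans (hS _))// (@le_trans _ _ `|u n - l|)//.
    by rewrite ler_piMl ?invf_le1 ?ler1n.
  by rewrite distrC ltW//; apply: nP => /=.
move=> M NM Mx; have [M0 Mlin] := nest_subspace (nestP N) NM.
apply: (closed_cvg _ (nest_closed (nestP N) NM) _ l ul).
apply: nearW; elim=> [//|n IH] /=.
by rewrite -[x]scale1r; apply: Mlin => //; exact: algP.
Qed.

Lemma neumann_inverse (S : alg N) :
  (forall y, `|S y| <= 2^-1 * `|y|) ->
  exists U : alg N, U * (1 - S) = 1 /\ (1 - S) * U = 1.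
Proof.
move=> hS; pose V x := sval (cid (neumann_fixpoint x hS)).
have VE x : V x = x + S (V x) by rewrite /V; case: cid => l [].
have VN x M : nest_sets N M -> M x -> M (V x).
  by rewrite /V; case: cid => l [? lN] /=; exact: lN.
have uniqV x l : l = x + S l -> l = V x.
  move=> lE; apply/eqP; rewrite -subr_eq0 -normr_eq0.
  have D : l - V x = S (l - V x).
    by rewrite {1}lE {1}VE opprD addrACA subrr add0r alg_mapB.
  have := hS (l - V x); rewrite -D -subr_le0 -{1}[`|_|]mul1r -mulrBl.
  have -> : 1 - 2^-1 = 2^-1 :> R[i] by field.
  by rewrite pmulr_rle0 ?invr_gt0// normr_le0 normr_eq0.
have Vlin : bounded_linear V.
  split=> [a x y|].
    apply/esym/uniqV; rewrite {1}VE {1}(VE y) scalerDr (bop_linear S).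
    by rewrite addrACA.
  exists 2 => x; have := ler_normD x (S (V x)); rewrite -VE => /le_trans.
  move=> /(_ (`|x| + 2^-1 * `|V x|)).
  rewrite lerD2l => /(_ (hS _)).
  rewrite -lerBlDr -{1}[`|V x|]mul1r -mulrBl.
  have -> : 1 - 2^-1 = 2^-1 :> R[i] by field.
  by rewrite mulrC ler_pdivrMr// mulrC.
have Vbop : V \in @bop_pred _ X by apply/asboolP.
have Valg : Bop Vbop \in alg_pred N.
  by apply/asboolP => M NM _ [x Mx <-]; exact: VN.
exists (Alg Valg); split; apply: alg_ext => x.
  apply/esym/uniqV => /=.
  by rewrite -[RHS]/(x - S x + S x) subrK.
by rewrite -[LHS]/(V x - S (V x)) {1}VE addrK.
Qed.

End Neumann.

Section NestAlgebraJordan.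
Variables (R : realType) (X : completeNormedModType R[i]) (N : nest X).

Lemma alg_scaleM (t u : R[i]) (A B : alg N) :
  (t *: A) * (u *: B) = (t * u) *: (A * B).
Proof. by apply: alg_ext => x; rewrite !(algME, algZE) alg_mapZ scalerA. Qed.

Lemma alg_torsion2 (A : alg N) : A + A = 0 -> A = 0.
Proof.
rewrite -mulr2n -scaler_nat => /eqP.
by rewrite scaler_eq0 pnatr_eq0 => /eqP.
Qed.

Lemma alg_closure_eq0 (A : alg N) (S : set X) :
  (forall x, S x -> A x = 0) -> forall y, closure S y -> A y = 0.
Proof.
move=> AS y Sy; apply/eqP/negPn/negP => Ay0.
have [M M0 AM] := bop_ge0_bound (alg_val A).
have M1 : 0 < M + 1 by rewrite ltr_wpDl.
have e0 : 0 < `|A y| / (M + 1) by rewrite divr_gt0// normr_gt0.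
have [x [Sx]] := Sy _ (nbhsx_ballx y _ e0).
rewrite -ball_normE /= ltr_pdivlMr// => yx.
have := AM (y - x); rewrite [X in `|X|]alg_mapB (AS _ Sx) subr0 => AyM.
suff : `|A y| < `|A y| by rewrite ltxx.
apply: (le_lt_trans AyM); apply: le_lt_trans yx.
by rewrite mulrC ler_wpM2l// lerDl.
Qed.

Lemma dense_range_cancel (Z A : alg N) : dense (range Z) -> A * Z = 0 -> A = 0.
Proof.
move=> dZ AZ; apply: alg_ext => y; apply: (@alg_closure_eq0 _ (range Z)).
  by move=> _ [x _ <-]; rewrite -algME AZ.
move=> B /nbhs_interior/nbhs_singleton Bo.
have [|x [? ?]] := dZ B^° _ (open_interior B); first by exists y.
by exists x; split=> //; exact: interior_subset.
Qed.

Lemma injective_cancel (Z A : alg N) : injective Z -> Z * A = 0 -> A = 0.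
Proof.
move=> iZ ZA; apply: alg_ext => y; apply: iZ.
by rewrite [RHS]alg_map0 -[LHS]/((Z * A) y) ZA.
Qed.

Lemma alg_small_scale (S : alg N) :
  exists2 t : R[i], t != 0 & forall y, `|t *: S y| <= 2^-1 * `|y|.
Proof.
have [M M0 SM] := bop_ge0_bound (alg_val S).
have M1 : 0 < M + 1 by rewrite ltr_wpDl.
have t0 : 0 < 2^-1 / (M + 1) by rewrite divr_gt0// invr_gt0.
exists (2^-1 / (M + 1)); first by rewrite gt_eqF.
move=> y; rewrite normrZ gtr0_norm// -mulrA ler_wpM2l ?invr_ge0//.
rewrite mulrC ler_pdivrMr// (le_trans (SM y))// mulrC ler_wpM2l//.
by rewrite lerDl.
Qed.

Lemma derivable_at_jordan_derivation (Z : alg N)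
    (delta : {linear alg N -> alg N}) :
  injective Z \/ dense (range Z) -> derivable_at delta Z ->
  jordan_derivation delta.
Proof.
move=> hZ dZ S; have [t t0 St] := alg_small_scale S.
pose s := t *: S.
suff : delta (s * s) = delta s * s + s * delta s.
  rewrite /s alg_scaleM !linearZ /= !alg_scaleM -scalerDr.
  by apply: scalerI; rewrite mulf_neq0.
have [u [us su]] : exists u : alg N, u * (1 - s) = 1 /\ (1 - s) * u = 1.
  exact: neumann_inverse.
have [w [ws sw]] : exists w : alg N, w * (1 - - s) = 1 /\ (1 - - s) * w = 1.
  by apply: neumann_inverse => y; rewrite [X in `|X|]/(- (t *: S y)) normrN.
rewrite opprK in ws sw.
case: hZ => [iZ|dnZ].
  rewrite addrC.
  (* In the converse ring, Z is right cancellable. *)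
  have zc (A : (alg N)^c) : A * (Z : (alg N)^c) = 0 -> A = 0.
    exact: injective_cancel.
  have dc (A B : (alg N)^c) : A * B = (Z : (alg N)^c) ->
    (delta A : (alg N)^c) * B + A * (delta B : (alg N)^c) = delta Z.
    by move=> /dZ <-; rewrite addrC.
  exact: (@derivable_at_jordan (alg N)^c delta Z alg_torsion2 zc dc s u w).
apply: (@derivable_at_jordan (alg N) delta Z alg_torsion2 _ dZ s u w) => //.
by move=> A; exact: dense_range_cancel.
Qed.

End NestAlgebraJordan.

(** * Jordan derivations of nest algebras *)

Section RankOne.
Variables (R : realType) (X : completeNormedModType R[i]) (N : nest X).
Implicit Types (f g : X -> R[i]) (A B T : alg N) (P Q M : set X).

Lemma functionalD f x y : scalar f -> f (x + y) = f x + f y.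
Proof. by move=> fl; rewrite -[x]scale1r fl mul1r scale1r. Qed.

Lemma functional0 f : scalar f -> f 0 = 0.
Proof. by move=> fl; apply: (addIr (f 0)); rewrite -functionalD// !add0r. Qed.

Lemma functionalZ f a x : scalar f -> f (a *: x) = a * f x.
Proof. by move=> fl; rewrite -[a *: x]addr0 fl functional0// addr0. Qed.

Definition rank1 T x f := forall y, T y = f y *: x.

Lemma rank1_exists x f : bounded_functional f ->
  (forall M, nest_sets N M -> M x \/ forall y, M y -> f y = 0) ->
  exists T, rank1 T x f.
Proof.
move=> [flin [m fm]] Nxf; pose V y := f y *: x.
have Vbop : V \in @bop_pred _ X.
  apply/asboolP; split=> [a y z|]; first by rewrite /V flin scalerDl scalerA.
  by exists (m * `|x|) => y; rewrite normrZ mulrAC ler_wpM2r.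
have Valg : Bop Vbop \in alg_pred N.
  apply/asboolP => M NM _ [y My <-] /=.
  have [M0 Mlin] := nest_subspace (nestP N) NM.
  have [Mx|Mf] := Nxf M NM; rewrite /V; last by rewrite Mf// scale0r.
  by rewrite -[_ *: _]addr0; exact: Mlin.
by exists (Alg Valg).
Qed.

Lemma nest_rank1 P x f : nest_sets N P -> P x -> bounded_functional f ->
  (forall y, P y -> f y = 0) -> exists T, rank1 T x f.
Proof.
move=> NP Px fb fP; apply: rank1_exists => // M NM.
have [PM|MP] := nest_chain (nestP N) NP NM; first by left; exact: PM.
by right=> y /MP; exact: fP.
Qed.

Variable delta : {linear alg N -> alg N}.
Hypothesis deltaJ : jordan_derivation delta.

Local Notation D := (defect delta).

Let algE := (algME, algDE, algNE, algZE).

Lemma defectE A B y : D A B y = delta (A * B) y - delta A (B y) - A (delta B y).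
Proof. by rewrite /defect !algE. Qed.

Lemma defectZr t A B : D A (t *: B) = t *: D A B.
Proof.
have AtB : A * (t *: B) = t *: (A * B).
  by apply: alg_ext => y; rewrite !algE alg_mapZ.
apply: alg_ext => y; rewrite algZE !defectE AtB !linearZ /=.
by rewrite !alg_mapZ !scalerBr.
Qed.

(* Writing v (x) f for y |-> f(y) v, the gap between P and Q splits x (x) f as
   (x (x) g)(u (x) f), whose factors multiply to 0 in the other order. *)
Lemma rank1_factor P Q x f T : nest_sets N P -> nest_sets N Q -> P `<` Q ->
  P x -> bounded_functional f -> (forall y, Q y -> f y = 0) -> rank1 T x f ->
  exists u g S1 S2, [/\ Q u, bounded_functional g /\ forall y, P y -> g y = 0,
    rank1 S1 x g, rank1 S2 u f & T = S1 * S2 /\ S2 * S1 = 0].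
Proof.
move=> NP NQ [PQ nQP] Px fb fQ Txf.
have [u Qu Pu] : exists2 u, Q u & ~ P u.
  apply: contrapT => nu; apply: nQP => u Qu.
  by apply: contrapT => Pu; apply: nu; exists u.
have [g [gb gP gu]] := separating_functional (nest_subspace (nestP N) NP)
  (nest_closed (nestP N) NP) Pu.
have [S1 S1E] := nest_rank1 NP Px gb gP.
have [S2 S2E] := nest_rank1 NQ Qu fb fQ.
exists u, g, S1, S2; split=> //; split; apply: alg_ext => y; rewrite algE.
  by rewrite Txf S1E S2E (functionalZ _ _ gb.1) gu mulr1.
by rewrite S2E S1E (functionalZ _ _ fb.1) fQ ?mulr0 ?scale0r//; exact: PQ.
Qed.

Lemma jordan_rank1_gap P Q x f T : nest_sets N P -> nest_sets N Q -> P `<` Q ->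
  P x -> bounded_functional f -> (forall y, Q y -> f y = 0) -> rank1 T x f ->
  (forall y, P y -> delta T y = 0) /\ forall y, Q (delta T y).
Proof.
move=> NP NQ PltQ Px fb fQ Txf; have PQ := PltQ.1.
have [u [g [S1 [S2 [Qu [_ gP] S1E S2E [-> S21]]]]]] :=
  rank1_factor NP NQ PltQ Px fb fQ Txf.
have [Q0 Qlin] := nest_subspace (nestP N) NQ.
have QD y z : Q y -> Q z -> Q (y + z) by rewrite -{2}[y]scale1r; exact: Qlin.
have QZ a y : Q y -> Q (a *: y) by rewrite -[a *: y]addr0 => ?; exact: Qlin.
have := jordanD deltaJ S1 S2; rewrite S21 addr0 => ->.
split=> y.
  move=> Py; rewrite !algE !S1E !S2E.
  rewrite (fQ y) ?(gP y)//; last exact: PQ.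
  rewrite (gP (delta S2 y)) ?(fQ (delta S1 y)) ?scale0r ?alg_map0 ?addr0//.
    by apply: PQ; exact: algP.
  exact: algP.
rewrite !algE !S1E !S2E.
have Qx := PQ _ Px.
apply: (QD); apply: (QD);
  [apply: (algP _ NQ)| |apply: (algP _ NQ)|]; exact: (QZ).
Qed.

Lemma defect_rank1_gap P P' Q Q' x f T A :
  nest_sets N P -> nest_sets N P' -> nest_sets N Q -> nest_sets N Q' ->
  P `<` P' -> P' `<` Q -> Q `<` Q' ->
  P x -> bounded_functional f -> (forall y, Q' y -> f y = 0) -> rank1 T x f ->
  D A T = 0.
Proof.
move=> NP NP' NQ NQ' PP' P'Q QQ' Px fb fQ' Txf.
have fQ y (Qy : Q y) : f y = 0 by apply: fQ'; exact: QQ'.1.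
have [u [g [S1 [S2 [Qu [gb gP'] S1E S2E [-> S21]]]]]] :=
  rank1_factor NP' NQ P'Q (PP'.1 _ Px) fb fQ Txf.
have [_ dS1] := jordan_rank1_gap NP NP' PP' Px gb gP' S1E.
have [dS2 _] := jordan_rank1_gap NQ NQ' QQ' Qu fb fQ' S2E.
apply: (defect_eq0_mul (@alg_torsion2 _ _ _) deltaJ) => //.
rewrite /defect S21 raddf0 sub0r -opprD; apply/eqP; rewrite oppr_eq0.
apply/eqP/alg_ext => y; rewrite !algE S1E S2E alg_mapZ dS2 ?scaler0 ?add0r.
  by rewrite fQ ?scale0r//; apply: P'Q.1.
exact/P'Q.1/PP'.1.
Qed.

Lemma defect_rank1_mul A B x f T w :
  scalar f -> f w = 1 -> rank1 T x f ->
  (forall C, D C T = 0) -> D A (B * T) = 0 -> D A B x = 0.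
Proof.
move=> fl fw TE DT DBT.
have /(congr1 (fun C : alg N => C w)) := defect_mul_eq0 DT DBT.
by rewrite algE TE fw scale1r.
Qed.

Definition proper_span := closed_span
  (\bigcup_(M in [set M | nest_sets N M /\ M <> setT]) M).

Lemma proper_span_sub P : nest_sets N P -> P <> setT -> P `<=` proper_span.
Proof.
move=> NP PT x Px; apply: subset_closure.
by apply: sub_gen_smallest; exists P.
Qed.

Lemma proper_span_nest : nest_sets N proper_span.
Proof. by apply: (nest_span (nestP N)) => M []. Qed.

Lemma proper_span_least Q : nest_sets N Q ->
  (forall P, nest_sets N P -> P <> setT -> P `<=` Q) -> proper_span `<=` Q.
Proof.
move=> NQ PQ; rewrite [Q]((closure_id _).1 (nest_closed (nestP N) NQ)).
apply: closure_subset; apply: smallest_sub.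
  exact: (nest_subspace (nestP N) NQ).
by move=> x [P [NP PT] Px]; exact: (PQ P).
Qed.

Lemma proper_span_next P : proper_span = setT -> nest_sets N P -> P <> setT ->
  exists Q, [/\ nest_sets N Q, Q <> setT & P `<` Q].
Proof.
move=> spanT NP PT; apply: contrapT => noQ; apply: PT.
apply/seteqP; split=> // x _; have : proper_span x by rewrite spanT.
apply: proper_span_least => // M NM MT.
have [PM|//] := nest_chain (nestP N) NP NM.
by apply: contrapT => MP; apply: noQ; exists M.
Qed.

Lemma defect_eq0_continuous_end (A B : alg N) : proper_span = setT -> D A B = 0.
Proof.
move=> spanT; apply: alg_ext => x.
have : proper_span x by rewrite spanT.
apply: alg_closure_eq0 => {}x.
pose ker : set X := [set y | D A B y = 0].
suff : smallest (@linear_subspace _ X)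
    (\bigcup_(M in [set M | nest_sets N M /\ M <> setT]) M) `<=` ker by apply.
apply: smallest_sub.
  split=> [|a y z]; first exact: alg_map0.
  move=> ky kz; apply: (etrans (bop_linear _ _ _ _)).
  by rewrite ky kz scaler0 addr0.
move=> {}x [P [NP PT] Px]; change (D A B x = 0).
have [P1 [NP1 P1T PP1]] := proper_span_next spanT NP PT.
have [P2 [NP2 P2T P12]] := proper_span_next spanT NP1 P1T.
have [P3 [NP3 P3T P23]] := proper_span_next spanT NP2 P2T.
have [w P3w] : exists w, ~ P3 w.
  apply: contrapT => nw; apply: P3T; apply/seteqP; split=> // y _.
  by apply: contrapT => P3y; apply: nw; exists y.
have [f [fb fP3 fw]] := separating_functional (nest_subspace (nestP N) NP3)
  (nest_closed (nestP N) NP3) P3w.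
have DP3 y T C : P y -> rank1 T y f -> D C T = 0.
  move=> Py.
  exact: (defect_rank1_gap _ NP NP1 NP2 NP3 PP1 P12 P23 Py fb fP3).
have fP y : P y -> f y = 0 by move=> Py; apply/fP3/P23.1/P12.1/PP1.1.
have [T TE] := nest_rank1 NP Px fb fP.
apply: (defect_rank1_mul fb.1 fw TE) => [C|]; first exact: DP3 TE.
apply: (DP3 (B x)); first exact: algP.
by move=> y; rewrite algE TE alg_mapZ.
Qed.

Section RankOneIdempotent.
Variables (f : X -> R[i]) (v : X) (p : alg N).
Hypotheses (fl : scalar f) (fv : f v = 1) (pE : rank1 p v f).

Let fZ a x : f (a *: x) = a * f x. Proof. exact: functionalZ. Qed.
Let fD x y : f (x + y) = f x + f y. Proof. exact: functionalD. Qed.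
Let fN x : f (- x) = - f x. Proof. by rewrite -scaleN1r fZ mulN1r. Qed.

Let idem_p : p * p = p.
Proof. by apply: alg_ext => y; rewrite algE !pE fZ fv mulr1. Qed.

Lemma jordan_idempotent_ker x : f x = 0 -> delta p x = f (delta p x) *: v.
Proof.
move=> fx; have /(congr1 (fun C : alg N => C x)) := deltaJ p.
by rewrite idem_p !algE !pE fx scale0r alg_map0 add0r.
Qed.

Lemma jordan_idempotent_diag : f (delta p v) = 0.
Proof.
have /(congr1 (fun C : alg N => f (C v))) := deltaJ p.
rewrite idem_p !algE !pE fv scale1r fD fZ fv mulr1 => /eqP.
by rewrite -{1}[f (delta p v)]addr0 eq_sym (inj_eq (addrI _)) => /eqP.
Qed.

Lemma defect_rank1_idempotent x T : f x = 0 -> rank1 T x f -> D p T = 0.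
Proof.
move=> fx TE; have [x0|x0] := eqVneq x 0.
  have -> : T = 0 by apply: alg_ext => y; rewrite TE x0 scaler0.
  by rewrite defectC// defect0l oppr0.
have pT : p * T = 0.
  by apply: alg_ext => y; rewrite algE TE pE fZ fx mulr0 scale0r.
have Tp : T * p = T.
  by apply: alg_ext => y; rewrite algE !TE pE fZ fv mulr1.
have TT : T * T = 0.
  by apply: alg_ext => y; rewrite algE !TE fZ fx mulr0 scale0r.
have dTT y : f y *: delta T x + f (delta T y) *: x = 0.
  have /(congr1 (fun C : alg N => C y)) := deltaJ T.
  by rewrite TT raddf0 !algE !TE alg_mapZ.
have dTv : f (delta p x) + f (delta T v) = 0.
  have /(congr1 (fun C : alg N => f (C v))) := jordanD deltaJ p T.
  rewrite pT Tp add0r !algE !pE !TE fv !scale1r !fD !fZ fv fx => E.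
  by apply: (addIr (f (delta T v))); rewrite add0r [RHS]E; ring.
have dTy y : f (delta T y) = f (delta T v) * f y.
  have dTx : delta T x = - f (delta T v) *: x.
    have /eqP := dTT v.
    by rewrite fv scale1r addr_eq0 scaleNr => /eqP.
  have := dTT y; rewrite dTx scalerA -scalerDl => /eqP.
  rewrite scaler_eq0 (negPf x0) orbF mulrN addrC subr_eq0 => /eqP ->.
  by rewrite mulrC.
apply: alg_ext => y; rewrite defectE pT raddf0 sub0r -opprD TE pE alg_mapZ.
rewrite jordan_idempotent_ker// scalerA -scalerDl dTy mulrC -mulrDl.
by rewrite dTv mul0r scale0r oppr0.
Qed.

Lemma defect_rank1_ker (A T : alg N) x : f x = 0 -> rank1 T x f -> D A T = 0.
Proof.
move=> fx TE; have <- : T * p = T.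
  by apply: alg_ext => y; rewrite algE !TE pE fZ fv mulr1.
apply: (defect_eq0_mul (@alg_torsion2 _ _ _) deltaJ).
  by apply: alg_ext => y; rewrite algE TE pE fZ fx mulr0 scale0r.
exact: defect_rank1_idempotent TE.
Qed.

Lemma jordan_rank1_row (s : alg N) (g : X -> R[i]) :
  scalar g -> g v = 0 -> rank1 s v g -> delta s v = - g (delta p v) *: v.
Proof.
move=> gl gv sE.
have gZ a x : g (a *: x) = a * g x by exact: functionalZ.
have ps : p * s = s by apply: alg_ext => y; rewrite algE pE sE fZ fv mulr1.
have sp : s * p = 0.
  by apply: alg_ext => y; rewrite algE sE pE gZ gv mulr0 scale0r.
have ss : s * s = 0.
  by apply: alg_ext => y; rewrite algE !sE gZ gv mulr0 scale0r.
have dsv : f (delta s v) = - g (delta p v).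
  have /(congr1 (fun C : alg N => f (C v))) := jordanD deltaJ p s.
  rewrite ps sp addr0 !algE !pE !sE gv fv scale0r alg_map0 add0r scale1r.
  rewrite !fD !fZ fv => E; apply: (addIr (f (delta s v) + g (delta p v))).
  by rewrite [f _ + g _]addrC addKr [RHS]E; ring.
have [g0|] := pselect (forall y, g y = 0).
  have -> : s = 0 by apply: alg_ext => y; rewrite sE g0 scale0r.
  by rewrite raddf0 g0 oppr0 scale0r.
move=> /existsNP[w /eqP gw].
have /(congr1 (fun C : alg N => C w)) := deltaJ s.
rewrite ss raddf0 !algE !sE alg_mapZ -[LHS]/0 => /esym/eqP.
rewrite addr_eq0 -scaleNr => /eqP E.
have dsvE : delta s v = ((g w)^-1 * - g (delta s w)) *: v.
  by rewrite -scalerA -E scalerA mulVf// scale1r.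
by rewrite -dsv {1}dsvE [in RHS]dsvE fZ fv mulr1.
Qed.

Lemma defect_idempotent (A : alg N) : D A p = 0.
Proof.
set a := f (A v); pose x := A v - a *: v; have dp0 := jordan_idempotent_diag.
have fx : f x = 0 by rewrite fD fN fZ fv mulr1 subrr.
have DAp : D A p = D A p * p.
  have := defect3Er delta A p p.
  rewrite defect3El idem_p (defectaa deltaJ) mulr0 addr0.
  move=> E; rewrite -[LHS]E.
  suff -> : defect delta (A * p) p = 0 by rewrite add0r.
  rewrite (defectC deltaJ) (_ : A * p = (A * p - a *: p) + a *: p); last first.
    by rewrite subrK.
  rewrite defectDr (@defect_rank1_idempotent x) ?add0r//; last first.
    move=> y; rewrite -[LHS]/(A (p y) - a *: p y) pE alg_mapZ scalerBr.
    by rewrite !scalerA [a * _]mulrC.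
  by rewrite defectZr (defectaa deltaJ) scaler0 oppr0.
suff Dv : D p A v = 0.
  apply: alg_ext => y; rewrite DAp algE pE alg_mapZ (defectC deltaJ).
  by rewrite -[X in _ *: X]/(- D p A v) Dv oppr0 scaler0.
pose g y := f (A y) - a * f y.
have gl : scalar g.
  by move=> c y z; rewrite /g alg_mapD alg_mapZ !fD !fZ; ring.
have gv : g v = 0 by rewrite /g fv mulr1 subrr.
have sE : rank1 (p * A - a *: p) v g.
  by move=> y; rewrite -[LHS]/(p (A y) - a *: p y) !pE scalerA -scalerBl.
have ds := jordan_rank1_row gl gv sE.
have dpA : delta (p * A) v = a *: delta p v - g (delta p v) *: v.
  rewrite -scaleNr -ds raddfB /= linearZ /=.
  by rewrite -[in RHS]/(delta (p * A) v - a *: delta p v) addrC subrK.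
have dpx : delta p (A v) = a *: delta p v + f (delta p x) *: v.
  by rewrite -jordan_idempotent_ker// /x alg_mapB alg_mapZ addrC subrK.
have pAp : f (delta p (A v)) + f (delta A v) + f (A (delta p v)) = 0.
  have := defect3C (@alg_torsion2 _ _ _) deltaJ p A p.
  move/eqP; rewrite -addr_eq0 => /eqP/alg_torsion2.
  have pApE : p * A * p = a *: p.
    by apply: alg_ext => y; rewrite !algE !pE alg_mapZ fZ scalerA mulrC.
  have dap : delta (a *: p) v = a *: delta p v by rewrite linearZ.
  rewrite /defect3 pApE => /(congr1 (fun C : alg N => f (C v))).
  rewrite !algE dap !pE fv !scale1r !fD !fN !fZ dp0 fv mulr0 functional0//.
  by move=> E; apply: oppr_inj; rewrite oppr0 -[RHS]E; ring.
rewrite defectE dpA pE dpx opprD addrACA subrr add0r -!scaleNr -!scalerDl.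
rewrite /g dp0 mulr0 subr0; move: pAp; rewrite dpx {dpx} fD !fZ dp0 fv => E.
rewrite (_ : _ + _ = 0) ?scale0r//; apply: oppr_inj.
by rewrite oppr0 -[RHS]E; ring.
Qed.

Lemma defect_eq0_idempotent A B :
  (forall x, exists T, rank1 T x f) -> D A B = 0.
Proof.
move=> fr; have DT C x T : rank1 T x f -> D C T = 0.
  move=> TE; rewrite (_ : T = (T - f x *: p) + f x *: p); last first.
    by rewrite subrK.
  rewrite defectDr defectZr defect_idempotent scaler0 addr0.
  apply: (@defect_rank1_ker _ _ (x - f x *: v)).
    by rewrite fD fN fZ fv mulr1 subrr.
  by move=> y; rewrite !algE TE pE scalerBr !scalerA [f x * _]mulrC.
apply: alg_ext => x; have [T TE] := fr x.
apply: (defect_rank1_mul fl fv TE) => [C|]; first exact: DT TE.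
by apply: (DT _ (B x)) => y; rewrite algE TE alg_mapZ.
Qed.

End RankOneIdempotent.

Lemma jordan_derivation_derivation : derivation delta.
Proof.
suff DAB A B : D A B = 0.
  by move=> A B; apply/eqP; rewrite -subr_eq0 opprD addrA; apply/eqP/DAB.
have [spanT|spanT] := pselect (proper_span = setT).
  exact: defect_eq0_continuous_end.
have [v spanv] : exists v, ~ proper_span v.
  apply: contrapT => nv; apply: spanT; apply/seteqP; split=> // y _.
  by apply: contrapT => ny; apply: nv; exists y.
have [f [fb fspan fv]] := separating_functional
  (nest_subspace (nestP N) proper_span_nest)
  (nest_closed (nestP N) proper_span_nest) spanv.
have fr x : exists T, rank1 T x f.
  apply: rank1_exists => // M NM.
  have [->|MT] := pselect (M = setT); first by left.
  by right=> y My; apply: fspan; exact: (proper_span_sub NM).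
have [p pE] := fr v.
exact: (defect_eq0_idempotent fb.1 fv pE).
Qed.

End RankOne.

Theorem theorem1p1 (R : realType) (X : completeNormedModType R[i])
    (dimX : dim_ge 2 X) (N : nest X) (Z : alg N)
    (hZ : injective Z \/ dense (range Z)) :
  (forall delta : {linear alg N -> alg N},
     derivable_at delta Z <-> derivation delta) /\
  all_derivable_point Z.
Proof.
have adp : all_derivable_point Z.
  move=> delta dZ; apply: jordan_derivation_derivation.
  exact: derivable_at_jordan_derivation dZ.
split=> // delta; split; first exact: adp.
by move=> dder A B <-.
Qed.
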